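(* Let $X$ be a Polish space, let $\mathscr{H}(K)$ be a reproducing kernel Hilbert space of Borel measurable functions $X\to\mathbb{F}$ with feature map $\phi: X\to\mathscr{H}(K)$, $\phi(x)=k_x$. Let $1\le p<\infty$, let $\mu$ be a Borel probability measure on $X$, and let $g\in L^p(X,\mu)$ be $\mathbb{F}$-valued. Assume that $\phi$ is a continuous $p$-frame for $\mathscr{H}(K)$ with respect to $\mu$, i.e. there exist $0<A\le B<+\infty$ such that for every $f\in\mathscr{H}(K)$ $$A\|f\|_{\mathscr{H}(K)}^p\le \int_X |\langle f,\phi(x)\rangle_{\mathscr{H}(K)}|^p\,d\mu(x)\le B\|f\|_{\mathscr{H}(K)}^p .$$ Then the problem $$\inf_{f\in\mathscr{H}(K)} \int_X |f(x)-g(x)|^p\,d\mu(x)$$ admits an optimizer $\hat f\in\mathscr{H}(K)$ (an element attaining the infimum). Furthermore, if $p>1$, the optimizer is unique.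
   Context: $\mathbb{F}=\mathbb{R}$ or $\mathbb{C}$. A reproducing kernel Hilbert space (RKHS) on $X$ is a vector subspace $\mathscr{H}$ of the space of all functions $X\to\mathbb{F}$ equipped with a Hilbert space inner product $\langle\cdot,\cdot\rangle$ ($\mathbb{F}$-linear in the first argument) such that each evaluation functional $f\mapsto f(x)$ is bounded. For $x\in X$, $k_x\in\mathscr{H}$ is the unique vector with $f(x)=\langle f,k_x\rangle$ for all $f\in\mathscr{H}$; the reproducing kernel is $K(y,x)=k_x(y)$, and $\mathscr{H}(K)$ denotes the RKHS with reproducing kernel $K$. Standing assumptions: $X$ is a Polish space, and all functions and measures are Borel measurable. *)

(* Defs.v *)
From HB Require Import structures.
From mathcomp Require Import all_boot all_order all_algebra.
From mathcomp Require Import all_classical all_reals all_analysis.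
From mathcomp Require Import sesquilinear complex.
Set Implicit Arguments.
Unset Strict Implicit.
Unset Printing Implicit Defensive.

Import Order.TTheory GRing.Theory Num.Theory.
Import numFieldNormedType.Exports.

Local Open Scope classical_set_scope.
Local Open Scope ring_scope.

Variant scalar_kind := RealScalars | ComplexScalars.

Definition scalar_field (R : realType) (k : scalar_kind) : numFieldType :=
  match k with
  | RealScalars => R
  | ComplexScalars => R[i]
  end.

Definition scalar_conj (R : realType) (k : scalar_kind) :
    scalar_field R k -> scalar_field R k :=
  match k return scalar_field R k -> scalar_field R k with
  | RealScalars => idfun
  | ComplexScalars => Num.conj
  end.

Definition scalar_re (R : realType) (k : scalar_kind) : scalar_field R k -> R :=
  match k return scalar_field R k -> R with
  | RealScalars => idfun
  | ComplexScalars => @complex.Re R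
  end.

(* In a normed module over a numFieldType F the norm takes its values in F
   (as nonnegative reals); [rnorm] is the same norm, as an element of R. It is
   also the modulus on scalars. *)
Definition rnorm (R : realType) (k : scalar_kind)
    (V : normedModType (scalar_field R k)) (v : V) : R :=
  scalar_re `|v|.

Definition borel (T : ptopologicalType) := g_sigma_algebraType (@open T).

Definition borel_fun (T U : ptopologicalType) (f : T -> U) : Prop :=
  measurable_fun setT (f : borel T -> borel U).

(* Polish spaces: separable, and homeomorphic (through h, with inverse h') to
   a complete metric space. *)
Definition polish (R : realType) (T : topologicalType) : Prop :=
  (exists2 S : set T, countable S & dense S) /\
  (exists (M : metricType R) (h : T -> M) (h' : M -> T),
    [/\ cancel h h', cancel h' h, continuous h, continuous h' &
        forall F : set_system M, ProperFilter F -> cauchy F -> exists l : M, F --> l]).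

(* The vector subspace of the space of all functions X -> F is the range of
   the injective linear map [rkhs_fun]; the Hilbert space structure is carried
   by [rkhs_sort]. The form [dotp] is linear in its first argument. *)
Record rkhs (R : realType) (k : scalar_kind) (X : Type) := Rkhs {
  rkhs_sort :> completeNormedModType (scalar_field R k) ;
  rkhs_fun : {linear rkhs_sort -> (X -> (scalar_field R k)^o)} ;
  dotp : {dot rkhs_sort for @scalar_conj R k} ;
  rkhs_fun_inj : injective rkhs_fun ;
  dotp_norm : forall f : rkhs_sort, dotp f f = `|f| ^+ 2 ;
  rkhs_eval_bounded : forall x : X,
    exists C : R, forall f : rkhs_sort, rnorm (rkhs_fun f x) <= C * rnorm f
}.

Arguments rkhs_fun {R k X r}.
Arguments dotp {R k X r}.

Section rkhs_notions.
Context {R : realType} {k : scalar_kind} {X : ptopologicalType}.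
Variable H : rkhs R k X.

Definition is_feature_map (phi : X -> H) : Prop :=
  forall (x : X) (f : H), rkhs_fun f x = dotp f (phi x).

Definition is_reproducing_kernel (K : X -> X -> scalar_field R k) : Prop :=
  exists2 phi : X -> H, is_feature_map phi &
    forall x y : X, K y x = rkhs_fun (phi x) y.

Variables (mu : probability (borel X) R) (p : R).

Definition is_p_frame (phi : X -> H) : Prop :=
  exists A B : R, [/\ 0 < A, A <= B & forall f : H,
    ((A * rnorm f `^ p)%:E <=
       \int[mu]_x (rnorm (dotp f (phi x) : (scalar_field R k)^o) `^ p)%:E <=
       (B * rnorm f `^ p)%:E)%E].

Definition in_Lp (g : X -> scalar_field R k) : Prop :=
  borel_fun g /\
  (\int[mu]_x (rnorm (g x : (scalar_field R k)^o) `^ p)%:E < +oo)%E.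

Definition Lp_error (g : X -> scalar_field R k) (f : H) : \bar R :=
  (\int[mu]_x (rnorm (rkhs_fun f x - g x) `^ p)%:E)%E.

Definition is_optimizer (g : X -> scalar_field R k) (f : H) : Prop :=
  Lp_error g f = ereal_inf (range (Lp_error g)).

End rkhs_notions.

(* Main.v *)
Require Import Defs.
From HB Require Import structures.
From mathcomp Require Import all_boot all_order all_algebra.
From mathcomp Require Import all_classical all_reals all_analysis.
From mathcomp Require Import sesquilinear complex measurable_realfun ring lra.
Import Order.TTheory GRing.Theory Num.Theory.
Import numFieldNormedType.Exports.
Local Open Scope classical_set_scope.
Local Open Scope ring_scope.

(* The error [E f = \int |f - g|^p] is midpoint convex (convexity of [t ^ p]),
   lower semicontinuous for the norm of [H] (Fatou's lemma: norm convergence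
   implies pointwise convergence in an RKHS), finite at [0], and coercive by the
   lower frame bound. Its sublevel sets are thus nested nonempty bounded closed
   convex sets of a Hilbert space, and the parallelogram law makes elements of
   nearly minimal norm in them converge to a common point, which is a minimizer.
   For [p > 1], [t ^ p] is strictly convex, so two minimizers agree almost
   everywhere as functions, hence are equal by the lower frame bound. *)

(** * Real-valued norms over either scalar field *)

Section rnorm_theory.
Context {R : realType} {k : scalar_kind}.

(** The embedding of the reals into the scalar field. It is injective and reflects the order, so a
    statement about [rnorm] can be proved on norms in the scalar field and pulled back. *)
Definition real_scalar : R -> scalar_field R k :=
  match k return R -> scalar_field R k with
  | RealScalars => idfun
  | ComplexScalars => real_complex R
  end.

Lemma real_scalarD : {morph real_scalar : x y / x + y}.
Proof. by rewrite /real_scalar; case: k => //= x y; rewrite rmorphD. Qed.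

Lemma real_scalarM : {morph real_scalar : x y / x * y}.
Proof. by rewrite /real_scalar; case: k => //= x y; rewrite rmorphM. Qed.

Lemma real_scalar1 : real_scalar 1 = 1.
Proof. by rewrite /real_scalar; case: k. Qed.

Lemma real_scalar0 : real_scalar 0 = 0.
Proof. by rewrite /real_scalar; case: k. Qed.

Lemma real_scalar2 : real_scalar 2 = 2.
Proof. by rewrite -[2%:R]/(1 + 1) real_scalarD real_scalar1. Qed.

Lemma ler_real_scalar : {mono real_scalar : x y / x <= y}.
Proof. by rewrite /real_scalar; case: k => //= x y; rewrite lecR. Qed.

Lemma real_scalar_inj : injective real_scalar.
Proof. exact: inc_inj ler_real_scalar. Qed.

Lemma ltr_real_scalar : {mono real_scalar : x y / x < y}.
Proof. exact: leW_mono ler_real_scalar. Qed.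

(** The order on [R[i]] compares only numbers with equal imaginary parts, so a nonnegative scalar is
    real. *)
Lemma ger0_real_scalar {x : scalar_field R k} :
  0 <= x -> real_scalar (scalar_re x) = x.
Proof.
rewrite /real_scalar; case: k x => //= -[a b].
by rewrite lecE /= => /andP[/eqP-> _].
Qed.

Section normed.
Context {V : normedModType (scalar_field R k)}.
Implicit Types u v : V.

Lemma normr_rnorm v : `|v| = real_scalar (rnorm v).
Proof. by rewrite /rnorm ger0_real_scalar. Qed.

Lemma rnorm_ge0 v : 0 <= rnorm v.
Proof. by rewrite -ler_real_scalar -normr_rnorm real_scalar0. Qed.

Lemma ler_rnormD u v : rnorm (u + v) <= rnorm u + rnorm v.
Proof. by rewrite -ler_real_scalar real_scalarD -!normr_rnorm ler_normD. Qed.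

Lemma rnormN v : rnorm (- v) = rnorm v.
Proof. by rewrite /rnorm normrN. Qed.

Lemma rnormB u v : rnorm (u - v) = rnorm (v - u).
Proof. by rewrite /rnorm distrC. Qed.

Lemma rnorm_eq0 v : rnorm v = 0 -> v = 0.
Proof.
by move=> v0; apply/eqP; rewrite -normr_eq0 normr_rnorm v0 real_scalar0.
Qed.

Lemma rnorm0 : rnorm (0 : V) = 0.
Proof.
by apply: real_scalar_inj; rewrite -normr_rnorm normr0 real_scalar0.
Qed.

Lemma rnorm_half v : rnorm (2^-1 *: v) = rnorm v / 2.
Proof.
have two0 : 2 != 0 :> scalar_field R k by rewrite pnatr_eq0.
apply: real_scalar_inj; rewrite -normr_rnorm normrZ.
have /normr_idP -> : 0 <= 2^-1 :> scalar_field R k by rewrite invr_ge0.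
rewrite real_scalarM -normr_rnorm mulrC; congr (_ * _).
apply: (mulfI two0); rewrite mulfV//.
by rewrite -real_scalar2 -real_scalarM mulfV ?real_scalar1.
Qed.

(** Stated for any normed module because it serves twice: in [H] for existence, and in the scalar
    field for the equality case of convexity. *)
Definition parallelogram_law : Prop :=
  forall u v, rnorm (u + v) ^+ 2 + rnorm (u - v) ^+ 2 =
              2 * rnorm u ^+ 2 + 2 * rnorm v ^+ 2.

End normed.

Lemma scalar_parallelogram_law :
  @parallelogram_law (scalar_field R k)^o.
Proof.
move=> u v; apply: real_scalar_inj.
rewrite !expr2 !(real_scalar2, real_scalarD, real_scalarM).
rewrite -!normr_rnorm -!expr2.
move: u v; rewrite /real_scalar; case: k => /= u v; last first.
  by rewrite !sqr_normc !rmorphD/= rmorphN/=; ring.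
by rewrite !real_normK ?num_real//; ring.
Qed.

(** Completeness in the form that suits the parallelogram law, which bounds squared distances. *)
Lemma rnorm_complete {V : completeNormedModType (scalar_field R k)}
    {u : nat -> V} {b : nat -> R} :
  b n @[n --> \oo] --> (0 : R) ->
  (forall n m, (n <= m)%N -> rnorm (u n - u m) ^+ 2 <= b n) ->
  exists l : V, rnorm (u n - l) @[n --> \oo] --> (0 : R).
Proof.
move=> b0 ub.
have /cauchy_cvg/cvg_ex[/= l ul] : cauchy (u @ \oo).
  apply/cauchy_ballP => e e0.
  (* The radius [e] is a positive scalar, hence the image of a real [r]. *)
  rewrite -(ger0_real_scalar (ltW e0)); set r := scalar_re e.
  have r0 : 0 < r.
    by rewrite -ltr_real_scalar real_scalar0 ger0_real_scalar// ltW.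
  have [N _ Nb] : \forall n \near \oo, b n < r ^+ 2.
    by apply: (cvgr_lt _ b0); rewrite exprn_gt0.
  have u_near n m : (N <= n)%N -> (N <= m)%N -> `|u n - u m| < real_scalar r.
    wlog nm : n m / (n <= m)%N.
      move=> h Nn Nm; have [/h->//|/ltnW mn] := leqP n m.
      by rewrite distrC h.
    move=> Nn _; rewrite normr_rnorm ltr_real_scalar.
    rewrite -ltr_sqr ?nnegrE ?rnorm_ge0 1?ltW//.
    exact: le_lt_trans (ub _ _ nm) (Nb _ Nn).
  exists ((u @` [set n | (N <= n)%N]), (u @` [set n | (N <= n)%N])).
    by split => /=; exists N => // n Nn; exists n.
  by move=> [_ _] [[n Nn <-] [m Nm <-]]; rewrite -ball_normE /=; exact: u_near.
exists l; apply/cvgrPdist_lt => e e0.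
have e0' : 0 < real_scalar e :> scalar_field R k.
  by rewrite -[ltLHS]real_scalar0 ltr_real_scalar.
move/cvgrPdist_lt : ul => /(_ _ e0'); apply: filterS => n.
rewrite distrC normr_rnorm ltr_real_scalar sub0r normrN.
by rewrite ger0_norm ?rnorm_ge0.
Qed.

End rnorm_theory.

Lemma rkhs_parallelogram_law (R : realType) (k : scalar_kind) (X : Type)
  (H : rkhs R k X) : @parallelogram_law R k H.
Proof.
move=> u v; apply: (@real_scalar_inj R k).
rewrite !expr2 !(real_scalar2, real_scalarD, real_scalarM).
rewrite -!normr_rnorm -!expr2.
rewrite -!dotp_norm.
have -> : dotp (u + v) (u + v) = dotp u u + dotp u v + (dotp v u + dotp v v).
  by rewrite linearDl !linearDr.
have -> : dotp (u - v) (u - v) = dotp u u - dotp u v - (dotp v u - dotp v v).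
  by rewrite linearBl !linearBr.
by ring.
Qed.

(** * Convexity and continuity of real powers *)

Section powR_convexity.
Context {R : realType}.
Implicit Types a b p u : R.

(** This is [1 + x < expR x] at [x = ln u], which is nonzero. *)
Lemma ln_lt_subr1 {u} : 0 < u -> u != 1 -> ln u < u - 1.
Proof.
move=> u0 u1; have : ln u != 0.
  by apply: contra u1 => /eqP lnu0; rewrite -(lnK u0) lnu0 expR0.
by move/expR_gt1Dx; rewrite lnK ?posrE// => ?; lra.
Qed.

(* Strict concavity of [ln]: [u] is the average of [c = 1 + p (u - 1)] and [1]
   with weights [1 / p] and [1 - 1 / p]. *)
Lemma powR_gt1Dx {p u} : 1 < p -> 0 <= u -> u != 1 -> 1 + p * (u - 1) < u `^ p.
Proof.
move=> p1; rewrite le_eqVlt => /predU1P[<- _|u0 u1].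
  by rewrite powR0; [lra|rewrite gt_eqF//; lra].
set c := 1 + _; have [c0|c0] := leP c 0.
  by rewrite (le_lt_trans c0)// powR_gt0.
rewrite -ltr_ln ?posrE ?powR_gt0// ln_powR.
(* The tangent bound for [ln] is taken at [c / u] and, strictly, at [u^-1]. Added with weights 1 and
   [p - 1], the right-hand sides cancel because [(c + (p - 1)) / u = p], which leaves
   [ln c < p * ln u]. *)
have lnc : ln (c / u) <= c / u - 1.
  have := @expR_ge1Dx R (ln (c / u)).
  by rewrite lnK ?posrE ?divr_gt0// => ?; lra.
have lnu : ln u^-1 < u^-1 - 1.
  by apply: ln_lt_subr1; rewrite ?invr_gt0// invr_eq1.
rewrite ln_div ?posrE// in lnc; rewrite lnV ?posrE// in lnu.
have : (c + (p - 1)) / u = p by rewrite /c; field; rewrite gt_eqF.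
have -> : (c + (p - 1)) / u = c / u + (p - 1) * u^-1 by ring.
move=> cu.
have : (p - 1) * (- ln u) < (p - 1) * (u^-1 - 1) by rewrite ltr_pM2l//; lra.
by lra.
Qed.

(** After division by the midpoint [m], both points differ from 1 and have mean 1, so the linear
    terms of [powR_gt1Dx] cancel in the sum. *)
Lemma powR_midpoint_lt {p a b} : 1 < p -> 0 <= a -> 0 <= b -> a != b ->
  ((a + b) / 2) `^ p < (a `^ p + b `^ p) / 2.
Proof.
move=> p1 a0 b0 ab; have [m mE] : exists m, m = (a + b) / 2 by eexists.
rewrite -mE.
have m0 : 0 < m.
  rewrite lt_neqAle eq_sym; apply/andP; split; last by lra.
  by apply: contra ab; move=> /eqP ?; apply/eqP; lra.
have am1 : a / m != 1.
  apply: contra ab; rewrite -subr_eq0 => /eqP amE; apply/eqP.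
  have : a = m by rewrite -[LHS](divfK (lt0r_neq0 m0)); nra.
  by lra.
have bm1 : b / m != 1.
  apply: contra ab; rewrite -subr_eq0 => /eqP amE; apply/eqP.
  have : b = m by rewrite -[LHS](divfK (lt0r_neq0 m0)); nra.
  by lra.
have am := powR_gt1Dx p1 (divr_ge0 a0 (ltW m0)) am1.
have bm := powR_gt1Dx p1 (divr_ge0 b0 (ltW m0)) bm1.
have apE : a `^ p = (a / m) `^ p * m `^ p.
  by rewrite -(powRM _ (divr_ge0 a0 (ltW m0)) (ltW m0)) (divfK (lt0r_neq0 m0)).
have bpE : b `^ p = (b / m) `^ p * m `^ p.
  by rewrite -(powRM _ (divr_ge0 b0 (ltW m0)) (ltW m0)) (divfK (lt0r_neq0 m0)).
have mp : 0 < m `^ p by exact: powR_gt0.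
rewrite apE bpE -mulrDl mulrAC ltr_pMl//.
have abm : a / m + b / m = 2.
  by rewrite -mulrDl; apply: (canLR (mulfK (lt0r_neq0 m0))); lra.
clear mE.
have : p * (a / m - 1) + p * (b / m - 1) = 0.
  by rewrite -mulrDr addrACA abm; ring.
by lra.
Qed.

Lemma powR_midpoint_le {p a b} : 1 <= p -> 0 <= a -> 0 <= b ->
  ((a + b) / 2) `^ p <= (a `^ p + b `^ p) / 2.
Proof.
rewrite le_eqVlt => /predU1P[<-|p1] a0 b0; first by rewrite !powRr1//; lra.
have [->|ab] := eqVneq a b; last exact/ltW/powR_midpoint_lt.
by rewrite -!mulr2n -(mulr_natr b) -(mulr_natr (b `^ p)) !mulfK.
Qed.

Lemma cvg_powR {p a} {u : nat -> R} : 1 <= p -> (forall n, 0 <= u n) ->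
  u n @[n --> \oo] --> a -> u n `^ p @[n --> \oo] --> a `^ p.
Proof.
move=> p1 u0 ua; have : 0 <= a.
  by apply: (cvgr_to_ge ua); near=> n; exact: u0.
rewrite le_eqVlt => /predU1P[a0|a0]; last first.
  have /derivable1_diffP/differentiable_continuous :
      derivable (@powR R ^~ p) a 1.
    by apply: derivable_powR; rewrite in_itv/= a0.
  by move=> /continuous_cvg; exact.
move: ua; rewrite -a0 => ua; rewrite powR0; last by rewrite gt_eqF//; lra.
have up : \forall n \near \oo, 0 <= u n `^ p <= u n.
  near=> n; rewrite powR_ge0/=.
  have un1 : u n < 1 by near: n; exact: (cvgr_lt _ ua).
  have [->|un0] := eqVneq (u n) 0; first by rewrite powR0// gt_eqF//; lra.
  rewrite -[leRHS]powRr1//; apply: ger_powR => //.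
  by rewrite (ltW un1) andbT lt_neqAle eq_sym un0 u0.
by apply: (@squeeze_cvgr _ _ _ _ (cst 0) u _ up) => //; exact: cvg_cst.
Unshelve. all: by end_near. Qed.

End powR_convexity.

(** * Existence of minimizers under the parallelogram law *)

(** The hypotheses on [J] concern only its sublevel sets: midpoint convexity, sequential closedness,
    boundedness. *)
Lemma exists_minimizer {R : realType} {k : scalar_kind}
    {V : completeNormedModType (scalar_field R k)} {J : V -> \bar R} :
  @parallelogram_law R k V ->
  (forall u v c, (J u <= c -> J v <= c -> J (2^-1 *: (u + v)) <= c)%E) ->
  (forall (u : nat -> V) l c, rnorm (u n - l) @[n --> \oo] --> (0 : R) ->
    (\forall n \near \oo, (J (u n) <= c)%E) -> (J l <= c)%E) ->
  (forall c : R, exists M, forall v, (J v <= c%:E)%E -> rnorm v <= M) ->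
  ereal_inf (range J) \is a fin_num ->
  exists v, J v = ereal_inf (range J).
Proof.
move=> plaw Jmid Jlsc Jcoer; set d := ereal_inf _ => dfin.
pose e (n : nat) : R := n.+1%:R^-1.
have e_gt0 n : 0 < e n by rewrite /e invr_gt0.
have e0 : e n @[n --> \oo] --> (0 : R) by exact: cvg_harmonic.
have e_anti n m : (n <= m)%N -> e m <= e n.
  by move=> nm; rewrite /e lef_pV2 ?posrE// ler_nat.
pose C n : set V := [set v | (J v <= (fine d + e n)%:E)%E].
pose S n : set R := [set rnorm v ^+ 2 | v in C n].
have C_anti n m : (n <= m)%N -> C m `<=` C n.
  by move=> nm v /le_trans; apply; rewrite lee_fin lerD2l e_anti.
have C_neq0 n : C n !=set0.
  have [_ [v _ <-] Jv] := lb_ereal_inf_adherent (e_gt0 n) dfin.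
  by exists v; rewrite /C/= EFinD fineK// ltW.
have Sinf n : has_inf (S n).
  split; first by have [v Cv] := C_neq0 n; exists (rnorm v ^+ 2); exists v.
  by exists 0 => _ [v _ <-]; rewrite sqr_ge0.
(* The squared distance from the origin to [C n]. It grows with [n] since the sets shrink, and stays
   below [M ^+ 2] since all of them lie in [C 0]. *)
pose s n := inf (S n).
have s_le n v : C n v -> s n <= rnorm v ^+ 2.
  by move=> Cv; apply: ge_inf; [case: (Sinf n)|exists v].
have /choice[u uP] n : exists v, C n v /\ rnorm v ^+ 2 < s n + e n.
  have [_ [v Cv <-] vlt] := inf_adherent (e_gt0 n) (Sinf n).
  by exists v.
have s_mono : nondecreasing_seq s.
  move=> n m nm; apply: lb_le_inf; first by case: (Sinf m).
  by move=> _ [v Cv <-]; apply/s_le/(C_anti _ _ nm).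
have [M MP] := Jcoer (fine d + e 0%N).
have s_bnd n : s n <= M ^+ 2.
  apply: (le_trans (s_le n (u n) (uP n).1)).
  have uM : rnorm (u n) <= M by apply/MP/(C_anti 0%N n); [|exact: (uP n).1].
  by rewrite ler_sqr ?nnegrE ?rnorm_ge0// (le_trans (rnorm_ge0 (u n))).
have s_cvg : cvgn s.
  by apply: nondecreasing_is_cvgn => //; exists (M ^+ 2) => _ [n _ <-].
(* For [n <= m] the midpoint of [u n] and [u m] lies in [C n], so its squared norm is at least
   [s n]. The parallelogram law then bounds the squared distance by [2 * (s n + e n) + 2 * (s m + e
   m) - 4 * s n], and [s m <= limn s], [e m <= e n]. *)
pose b n := 2 * (limn s - s n) + 4 * e n.
have b0 : b n @[n --> \oo] --> (0 : R).
  have -> : 0 = 2 * (limn s - limn s) + 4 * 0 :> R by ring.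
  by apply: cvgD; apply: cvgMr => //; apply: cvgB => //; exact: cvg_cst.
have [|l ul] := @rnorm_complete _ _ _ u _ b0.
  move=> n m nm; have := plaw (u n) (u m).
  have /s_le : C n (2^-1 *: (u n + u m)).
    by apply: Jmid; [exact: (uP n).1|apply: (C_anti _ _ nm); exact: (uP m).1].
  rewrite rnorm_half.
  have [_ un] := uP n; have [_ um] := uP m.
  have sm : s m <= limn s by exact: nondecreasing_cvgn_le.
  have := e_anti _ _ nm.
  by rewrite expr_div_n /b; lra.
exists l; apply/eqP; rewrite eq_le; apply/andP; split; last first.
  by apply: ereal_inf_lbound; exists l.
(* For each [r > 0] the sequence eventually stays in the sublevel set of level [d + r], which is
   closed and so contains [l]. *)
apply/lee_addgt0Pr => r r0.
have [N _ Ner] : \forall n \near \oo, e n < r by exact: (cvgr_lt _ e0).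
apply: (Jlsc u l) => //; exists N => // n /= Nn.
apply: (le_trans (uP n).1); rewrite EFinD fineK//.
by rewrite leeD2l// lee_fin ltW//; exact: Ner.
Qed.

(** * Real coordinates of scalars *)

Section scalar_coordinates.
Context {R : realType} {k : scalar_kind}.
Implicit Types z w : (scalar_field R k)^o.

(** Zero for real scalars, so that the modulus formula [rnormE] covers both fields. *)
Definition scalar_im : scalar_field R k -> R :=
  match k return scalar_field R k -> R with
  | RealScalars => fun=> 0
  | ComplexScalars => @complex.Im R
  end.

Lemma scalar_reB : {morph @scalar_re R k : z w / z - w}.
Proof. by case: k => //= -[a b] [c d]. Qed.

Lemma scalar_imB : {morph scalar_im : z w / z - w}.
Proof.
by rewrite /scalar_im; case: k => [|[a b] [c d]] //= _ _; rewrite subr0.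
Qed.

Lemma rnormE z : rnorm z = Num.sqrt (scalar_re z ^+ 2 + scalar_im z ^+ 2).
Proof.
rewrite /rnorm /scalar_im; case: k z => z /=.
  by rewrite expr0n addr0 sqrtr_sqr.
exact: (congr1 (@complex.Re R) (normc_def z)).
Qed.

Lemma scalar_lipschitz_continuous (h : scalar_field R k -> R) :
  (forall z w, `|h z - h w| <= rnorm (z - w)) -> continuous h.
Proof.
move=> h_lip z.
apply/(@cvgrPdist_lt _ _ _ (nbhs (z : scalar_field R k))) => e e0.
have e0' : 0 < real_scalar e :> scalar_field R k.
  by rewrite -[ltLHS]real_scalar0 ltr_real_scalar.
apply/nbhs_ballP; exists (real_scalar e) => // w.
rewrite -ball_normE /= => zw; apply: le_lt_trans (h_lip z w) _.
rewrite -(@ltr_real_scalar R k).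
by rewrite -(@normr_rnorm R k (scalar_field R k)^o).
Qed.

Lemma continuous_scalar_re : continuous (@scalar_re R k).
Proof.
apply: scalar_lipschitz_continuous => z w.
by rewrite -scalar_reB rnormE -sqrtr_sqr ler_wsqrtr// lerDl sqr_ge0.
Qed.

Lemma continuous_scalar_im : continuous scalar_im.
Proof.
apply: scalar_lipschitz_continuous => z w.
by rewrite -scalar_imB rnormE -sqrtr_sqr ler_wsqrtr// lerDr sqr_ge0.
Qed.

End scalar_coordinates.

(** * Measurability of the integrands *)

Section measurability.
Context {R : realType} {k : scalar_kind} {T : ptopologicalType}.

(** Open intervals generate the Borel sets of [R], and their preimages under [h] are open, hence
    among the sets that [borel_fun] tests. *)
Lemma measurable_continuous_comp {f : T -> scalar_field R k}
    {h : scalar_field R k -> R} : borel_fun f -> continuous h ->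
  measurable_fun setT (h \o f : borel T -> R).
Proof.
move=> mf ch.
apply: (measurability _ (RGenOpens.measurableE R)).
move=> _ [_ [a [b ->]] <-].
apply: (mf measurableT (h @^-1` [set` `]a, b[])).
apply: sub_sigma_algebra; move/continuousP : ch; apply.
exact: interval_open.
Qed.

Lemma measurable_rnormB {f g : T -> scalar_field R k} :
  borel_fun f -> borel_fun g ->
  measurable_fun setT
    (fun x : borel T => rnorm (f x - g x : (scalar_field R k)^o)).
Proof.
(* Measurability of [f - g] itself is not available for Borel functions into
   [R[i]], hence the detour through the real coordinates. *)
move=> mf mg.
have mre (h : T -> scalar_field R k) : borel_fun h ->
    measurable_fun setT (@scalar_re R k \o h : borel T -> R).
  by move=> mh; exact: measurable_continuous_comp mh continuous_scalar_re.
have mim (h : T -> scalar_field R k) : borel_fun h ->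
    measurable_fun setT (scalar_im \o h : borel T -> R).
  by move=> mh; exact: measurable_continuous_comp mh continuous_scalar_im.
under eq_fun do rewrite rnormE scalar_reB scalar_imB.
apply: (measurableT_comp (continuous_measurable_fun (@sqrt_continuous R))).
by apply: measurable_funD; apply: measurable_funX; apply: measurable_funB;
  [exact: mre|exact: mre|exact: mim|exact: mim].
Qed.

Lemma measurable_rnorm {f : T -> scalar_field R k} : borel_fun f ->
  measurable_fun setT (fun x : borel T => rnorm (f x : (scalar_field R k)^o)).
Proof.
move=> mf; have m0 : @borel_fun T (scalar_field R k) (fun=> 0).
  exact: measurable_cst.
by have := measurable_rnormB mf m0; under eq_fun do rewrite subr0.
Qed.

End measurability.

(** * Lower limits and vanishing integrals *)

Lemma limn_einf_le {R : realType} {u : (\bar R)^nat} {c : \bar R} :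
  (\forall n \near \oo, (u n <= c)%E) -> (limn_einf u <= c)%E.
Proof.
move=> uc; rewrite limn_einf_lim; apply: lime_le; first exact: is_cvg_einfs.
apply: filterS uc => n; apply: le_trans.
by apply: ereal_inf_lbound; exists n => /=.
Qed.

(** A nonnegative function with zero integral vanishes almost everywhere, and the pointwise
    implication passes this on to [h]. *)
Lemma ge0_integral_eq0_sub {d} {T : measurableType d} {R : realType}
    {mu : {measure set T -> \bar R}} {f h : T -> \bar R} :
  measurable_fun setT f -> measurable_fun setT h ->
  (forall x, 0 <= f x)%E -> (forall x, 0 <= h x)%E ->
  (forall x, f x = 0 -> h x = 0)%E ->
  (\int[mu]_x f x = 0 -> \int[mu]_x h x = 0)%E.
Proof.
move=> mf mh f0 h0 fh.
under eq_integral do rewrite -[f _]gee0_abs//.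
move/(ae_eq_integral_abs mu measurableT mf) => f_ae0.
rewrite (@ge0_ae_eq_integral _ _ _ _ _ _ (cst 0%E)) ?integral0//.
by apply: filterS f_ae0 => x /(_ I)/fh.
Qed.

(** * Convexity of powers of the norm *)

Section rnorm_powR.
Context {R : realType} {k : scalar_kind} {V : normedModType (scalar_field R k)}.
Implicit Types (u v : V) (p : R).

Lemma rnorm_powR_midpoint {p} u v : 1 <= p ->
  rnorm (2^-1 *: (u + v)) `^ p <= (rnorm u `^ p + rnorm v `^ p) / 2.
Proof.
move=> p1; apply: le_trans (powR_midpoint_le p1 (rnorm_ge0 u) (rnorm_ge0 v)).
apply: ge0_ler_powR;
  rewrite ?nnegrE ?rnorm_ge0 ?divr_ge0 ?addr_ge0 ?rnorm_ge0//.
  exact: le_trans p1.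
by rewrite rnorm_half ler_pM2r ?invr_gt0// ler_rnormD.
Qed.

(** Strict convexity of the power forces [rnorm u = rnorm v]. The midpoint then has this same norm,
    and the parallelogram law leaves [rnorm (u - v) = 0]. *)
Lemma rnorm_powR_midpoint_eq {p u v} : @parallelogram_law R k V -> 1 < p ->
  rnorm (2^-1 *: (u + v)) `^ p = (rnorm u `^ p + rnorm v `^ p) / 2 -> u = v.
Proof.
move=> plaw p1 midE; have p0 : 0 < p by exact: lt_trans p1.
have le_mid : rnorm (2^-1 *: (u + v)) <= (rnorm u + rnorm v) / 2.
  by rewrite rnorm_half ler_pM2r ?invr_gt0// ler_rnormD.
have [uv|/(powR_midpoint_lt p1 (rnorm_ge0 u) (rnorm_ge0 v))] :=
    eqVneq (rnorm u) (rnorm v); last first.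
  rewrite -midE ltNge => /negP[]; apply: ge0_ler_powR => //;
  by rewrite ?(ltW p0)// nnegrE ?rnorm_ge0// divr_ge0// addr_ge0// rnorm_ge0.
have midv : rnorm (2^-1 *: (u + v)) = rnorm v.
  apply: (powR_injective p0); rewrite ?nnegrE ?rnorm_ge0// midE uv.
  by rewrite -mulr2n -(mulr_natr (_ `^ _)) mulfK.
apply/eqP; rewrite -subr_eq0; apply/eqP/rnorm_eq0/eqP.
rewrite -sqrf_eq0; have := plaw u v; move: midv; rewrite rnorm_half uv.
by move=> ? ?; apply/eqP; nra.
Qed.

Lemma ler_dist_rnorm u v : `|rnorm u - rnorm v| <= rnorm (u - v).
Proof.
rewrite ler_norml; apply/andP; split.
  by have := ler_rnormD u (v - u); rewrite addrC subrK rnormB; lra.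
by have := ler_rnormD v (u - v); rewrite addrC subrK; lra.
Qed.

Lemma rnorm_powR_split {p} u v : 1 <= p ->
  rnorm u `^ p <= 2 `^ p * (rnorm (u - v) `^ p + rnorm v `^ p).
Proof.
move=> p1; have p0 : 0 <= p by exact: le_trans p1.
have -> : rnorm u = 2 * rnorm (2^-1 *: (u - v + v)).
  by rewrite subrK rnorm_half; field.
rewrite powRM ?rnorm_ge0// ler_wpM2l ?powR_ge0//.
apply: le_trans (rnorm_powR_midpoint _ _ p1) _.
have := powR_ge0 (rnorm (u - v)) p; have := powR_ge0 (rnorm v) p; lra.
Qed.

End rnorm_powR.

(** * The error functional: finiteness, convexity, lower semicontinuity *)

Section Lp_error_theory.
Context {R : realType} {k : scalar_kind} {X : ptopologicalType}.
Context {H : rkhs R k X} {mu : probability (borel X) R} {p : R}.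
Context {g : X -> scalar_field R k}.
Context (p_ge1 : 1 <= p).
Context (H_borel :
  forall f : H, borel_fun (rkhs_fun f : X -> scalar_field R k)).
Context (g_Lp : in_Lp mu p g).

Let err (f : H) (x : borel X) : R := rnorm (rkhs_fun f x - g x) `^ p.
Let err_ge0 f x : 0 <= err f x. Proof. exact: powR_ge0. Qed.

Let measurable_err f : measurable_fun setT (err f).
Proof.
apply: (measurableT_comp (measurable_powR p)).
by apply: measurable_rnormB (H_borel f) _; case: g_Lp.
Qed.

Let measurable_Eerr f : measurable_fun setT (EFin \o err f).
Proof. exact/measurable_EFinP. Qed.

Let LpE f : Lp_error mu p g f = (\int[mu]_x (err f x)%:E)%E.
Proof. by []. Qed.

Lemma Lp_error_ge0 (f : H) : (0 <= Lp_error mu p g f)%E.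
Proof. by apply: integral_ge0 => x _; rewrite lee_fin powR_ge0. Qed.

(** The zero function already has the finite error given by the integral of [|g| ^ p]. *)
Lemma inf_Lp_error_fin_num :
  ereal_inf (range (@Lp_error _ _ _ H mu p g)) \is a fin_num.
Proof.
rewrite ge0_fin_numE; last first.
  by apply: le_ereal_inf_tmp => _ [f _ <-]; exact: Lp_error_ge0.
apply: le_lt_trans (proj2 g_Lp); apply: ge_ereal_inf.
exists (Lp_error mu p g (0 : H)); first by exists 0.
by rewrite /Lp_error linear0; under eq_integral do rewrite sub0r rnormN.
Qed.

Let err_half (u v : H) x : rkhs_fun (2^-1 *: (u + v)) x - g x =
  2^-1 *: ((rkhs_fun u x - g x) + (rkhs_fun v x - g x)) :> (scalar_field R k)^o.
Proof.
have gE : 2^-1 *: (g x + g x) = g x :> (scalar_field R k)^o.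
  rewrite scalerDr -scalerDl -mulr2n -(mulr_natr 2^-1).
  by rewrite mulVf ?scale1r// pnatr_eq0.
by rewrite linearZ linearD /= addrACA -opprD scalerBr gE.
Qed.

Let err_midpoint (u v : H) x :
  err (2^-1 *: (u + v)) x <= 2^-1 * (err u x + err v x).
Proof. by rewrite mulrC /err err_half; exact: rnorm_powR_midpoint. Qed.

Let integral_err_mean (u v : H) :
  (\int[mu]_x (2^-1 * (err u x + err v x))%:E =
   2^-1%:E * (Lp_error mu p g u + Lp_error mu p g v))%E.
Proof.
under eq_integral do rewrite EFinM.
rewrite ge0_integralZl_EFin//=.
- under eq_integral do rewrite EFinD.
  by rewrite ge0_integralD//; do ?[exact: measurable_Eerr];
    move=> x _; rewrite lee_fin err_ge0.
- by move=> x _; rewrite lee_fin addr_ge0 ?err_ge0.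
- exact/measurable_EFinP/measurable_funD.
Qed.

Lemma Lp_error_midpoint (u v : H) (c : \bar R) :
  (Lp_error mu p g u <= c -> Lp_error mu p g v <= c ->
   Lp_error mu p g (2^-1 *: (u + v)) <= c)%E.
Proof.
move=> uc vc; rewrite LpE.
apply: (@le_trans _ _ (\int[mu]_x (2^-1 * (err u x + err v x))%:E)%E).
  apply: ge0_le_integral => //.
  - by move=> x _; rewrite lee_fin err_ge0.
  - exact: measurable_Eerr.
  - apply/measurable_EFinP; apply: measurable_funM => //.
    exact: measurable_funD.
  - by move=> x _; rewrite lee_fin err_midpoint.
rewrite integral_err_mean; apply: (@le_trans _ _ (2^-1%:E * (c + c))%E).
  have half_ge0 : (0 <= (2^-1 : R)%:E)%E by rewrite lee_fin invr_ge0.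
  by have := lee_wpmul2l half_ge0 (leeD uc vc).
case: c {uc vc} => [c| |]; last by rewrite gt0_muleNy.
  by rewrite -EFinD -EFinM lee_fin -mulr2n -(mulr_natl c) mulKf.
by rewrite leey.
Qed.

Lemma Lp_error_lsc (u : nat -> H) (l : H) (c : \bar R) :
  rnorm (u n - l) @[n --> \oo] --> (0 : R) ->
  (\forall n \near \oo, (Lp_error mu p g (u n) <= c)%E) ->
  (Lp_error mu p g l <= c)%E.
Proof.
move=> ul uc.
have err_cvg x : err (u n) x @[n --> \oo] --> err l x.
  apply: cvg_powR => //; first by move=> n; exact: rnorm_ge0.
  have [C HC] := rkhs_eval_bounded H x.
  (* The reverse triangle inequality cancels [g x], and bounded evaluation at [x] controls what
     remains. *)
  pose b n := C * rnorm (u n - l).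
  have b0 : b n @[n --> \oo] --> (0 : R).
    by rewrite -(mulr0 C); apply: cvgMr.
  have le_b n : `|rnorm (rkhs_fun (u n) x - g x : (scalar_field R k)^o) -
                  rnorm (rkhs_fun l x - g x : (scalar_field R k)^o)| <= b n.
    apply: le_trans (ler_dist_rnorm _ _) _.
    rewrite opprB addrA subrK; apply: le_trans (HC _).
    by rewrite linearB.
  apply/cvgrPdist_le => e e0.
  have : \forall n \near \oo, b n < e by exact: (cvgr_lt _ b0).
  by apply: filterS => n bn; rewrite distrC (le_trans (le_b n))// ltW.
(* The pointwise limit is rewritten as a lower limit, the form in which Fatou's lemma applies. *)
have -> : Lp_error mu p g l =
    (\int[mu]_x limn_einf (fun n => (err (u n) x)%:E))%E.
  apply: eq_integral => x _.
  have /cvg_limn_einf_sup[-> _//] :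
    (err (u n) x)%:E @[n --> \oo] --> (err l x)%:E.
  by apply: cvg_EFin; [exact: nearW|exact: err_cvg].
apply: le_trans (fatou mu measurableT _ _) _.
- by move=> n; exact: measurable_Eerr.
- by move=> n x _; rewrite lee_fin err_ge0.
- exact: limn_einf_le.
Qed.

(** * Coercivity and uniqueness from the lower frame bound *)

Section frame.
Context {phi : X -> H}.
Context (phi_feature : is_feature_map phi).
Context (phi_frame : is_p_frame mu p phi).

(** The feature map identity turns the frame coefficient of [f] at [x] into the value of [f] at
    [x]. *)
Let frame_lower : exists2 A : R, 0 < A & forall f : H,
  ((A * rnorm f `^ p)%:E <=
    \int[mu]_x (rnorm (rkhs_fun f x : (scalar_field R k)^o) `^ p)%:E)%E.
Proof.
have [A [B [A0 _ AB]]] := phi_frame; exists A => // f.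
have /andP[+ _] := AB f; move/le_trans; apply.
by under eq_integral do rewrite -phi_feature.
Qed.

Lemma Lp_error_coercive (c : R) :
  exists M : R, forall f : H, (Lp_error mu p g f <= c%:E)%E -> rnorm f <= M.
Proof.
have [A A0 lowerA] := frame_lower.
have [mg g_fin] := g_Lp.
set G := (\int[mu]_x (rnorm (g x : (scalar_field R k)^o) `^ p)%:E)%E in g_fin.
have mGp : measurable_fun setT
    (fun x : borel X => rnorm (g x : (scalar_field R k)^o) `^ p).
  apply: (measurableT_comp (measurable_powR p)).
  exact: measurable_rnorm.
have Gfin : G \is a fin_num.
  by rewrite ge0_fin_numE// integral_ge0// => x _; rewrite lee_fin powR_ge0.
(* A bound on [rnorm f]^ p[yields this one without a root: either]rnorm f <= 1[, or]rnorm f <= rnorm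
   f [^ p]. *)
exists (1 + (2 `^ p * (c + fine G)) / A) => f fc.
suff fp : A * rnorm f `^ p <= 2 `^ p * (c + fine G).
  have : rnorm f `^ p <= 2 `^ p * (c + fine G) / A.
    by rewrite ler_pdivlMr// mulrC.
  have [f1|f1] := leP (rnorm f) 1.
    by have := powR_ge0 (rnorm f) p; lra.
  have : rnorm f <= rnorm f `^ p.
    by rewrite -[leLHS]powRr1 ?rnorm_ge0// ler_powR// ltW.
  by lra.
rewrite -lee_fin; apply: le_trans (lowerA f) _.
apply: (@le_trans _ _ (\int[mu]_x ((2 `^ p)%:E *
    ((err f x)%:E + (rnorm (g x : (scalar_field R k)^o) `^ p)%:E)))%E).
  apply: ge0_le_integral => //.
  - by move=> x _; rewrite lee_fin powR_ge0.
  - apply/measurable_EFinP/(measurableT_comp (measurable_powR p)).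
    exact: measurable_rnorm.
  - apply/measurable_EFinP; apply: measurable_funM => //.
    exact: measurable_funD.
  - by move=> x _; rewrite -EFinD -EFinM lee_fin; exact: rnorm_powR_split.
rewrite ge0_integralZl_EFin ?powR_ge0//.
- rewrite ge0_integralD//.
  + rewrite -LpE EFinM lee_pmul2l ?lte_fin ?powR_gt0//.
    by rewrite EFinD fineK// leeD.
  + by move=> x _; rewrite lee_fin err_ge0.
  + exact: measurable_Eerr.
  + by move=> x _; rewrite lee_fin powR_ge0.
  + exact/measurable_EFinP.
- by move=> x _; rewrite -EFinD lee_fin addr_ge0 ?err_ge0 ?powR_ge0.
- by apply/measurable_EFinP; exact: measurable_funD.
Qed.

Lemma optimizer_unique (u v : H) : 1 < p ->
  is_optimizer mu p g u -> is_optimizer mu p g v -> u = v.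
Proof.
rewrite /is_optimizer => p_gt1; set d := ereal_inf _ => uE vE.
have dfin : d \is a fin_num := inf_Lp_error_fin_num.
pose w := 2^-1 *: (u + v).
(* The pointwise convexity gap at the midpoint [w]. It is nonnegative, and optimality of [u] and [v]
   will make its integral zero. *)
pose D x := 2^-1 * (err u x + err v x) - err w x.
have D_ge0 x : 0 <= D x by rewrite subr_ge0 err_midpoint.
have mD : measurable_fun setT D.
  apply: measurable_funB => //; apply: measurable_funM => //.
  exact: measurable_funD.
(* Written as a sum, so that additivity for nonnegative functions applies before the error of [w] is
   known to be finite. *)
have intD : (\int[mu]_x (D x)%:E + Lp_error mu p g w = d)%E.
  rewrite LpE -ge0_integralD//.
  - under eq_integral do rewrite -EFinD subrK.
    rewrite integral_err_mean uE vE -(fineK dfin) -EFinD -EFinM.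
    by congr EFin; field.
  - by move=> x _; rewrite lee_fin.
  - exact/measurable_EFinP.
  - by move=> x _; rewrite lee_fin err_ge0.
  - exact: measurable_Eerr.
have D0 : (\int[mu]_x (D x)%:E = 0)%E.
  apply/eqP; rewrite eq_le; apply/andP; split; last first.
    by apply: integral_ge0 => x _; rewrite lee_fin.
  have dw : (d <= Lp_error mu p g w)%E by apply: ereal_inf_lbound; exists w.
  rewrite -(leeD2rE _ _ dfin) add0e -[leRHS]intD.
  exact: leeD2l.
have uv0 : (\int[mu]_x
    (rnorm (rkhs_fun (u - v) x : (scalar_field R k)^o) `^ p)%:E = 0)%E.
  apply: ge0_integral_eq0_sub D0; first exact/measurable_EFinP.
  - apply/measurable_EFinP/(measurableT_comp (measurable_powR p)).
    exact: measurable_rnorm.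
  - by move=> x; rewrite lee_fin.
  - by move=> x; rewrite lee_fin powR_ge0.
  move=> x [Dx0].
  (* Where the gap vanishes, the scalar midpoint inequality is an equality. *)
  have uv_g : rkhs_fun u x - g x = rkhs_fun v x - g x :> (scalar_field R k)^o.
    apply: (rnorm_powR_midpoint_eq scalar_parallelogram_law p_gt1).
    rewrite -err_half; apply/esym/eqP; rewrite -subr_eq0 mulrC; apply/eqP.
    exact: Dx0.
  have -> : rkhs_fun (u - v) x = rkhs_fun u x - rkhs_fun v x by rewrite linearB.
  by rewrite (addIr _ uv_g) subrr rnorm0 powR0// gt_eqF// (lt_trans _ p_gt1).
apply/eqP; rewrite -subr_eq0; apply/eqP/rnorm_eq0.
have [A A0 lowerA] := frame_lower.
have := lowerA (u - v); rewrite uv0 lee_fin pmulr_rle0// => uvp.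
apply: (@powR_eq0_eq0 _ _ p); apply/eqP.
by rewrite eq_le uvp powR_ge0.
Qed.

End frame.

End Lp_error_theory.

Theorem theorem2p2 (R : realType) (k : scalar_kind) (X : ptopologicalType)
    (X_polish : polish R X)
    (H : rkhs R k X) (K : X -> X -> scalar_field R k) (phi : X -> H)
    (H_borel : forall f : H, borel_fun (rkhs_fun f : X -> scalar_field R k))
    (K_kernel : is_reproducing_kernel H K) (phi_feature : is_feature_map phi)
    (p : R) (p_ge1 : 1 <= p)
    (mu : probability (borel X) R)
    (g : X -> scalar_field R k) (g_Lp : in_Lp mu p g)
    (phi_frame : is_p_frame mu p phi) :
  exists fhat : H, is_optimizer mu p g fhat /\
    (1 < p -> forall f : H, is_optimizer mu p g f -> f = fhat).
Proof.
have [fhat fhatP] : exists fhat : H, is_optimizer mu p g fhat.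
  apply: exists_minimizer.
  - exact: rkhs_parallelogram_law.
  - exact: Lp_error_midpoint.
  - exact: Lp_error_lsc.
  - by move=> c; exact: Lp_error_coercive.
  - exact: inf_Lp_error_fin_num.
exists fhat; split=> // p_gt1 f fP.
exact: (optimizer_unique p_ge1 H_borel g_Lp phi_feature phi_frame).
Qed.
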